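(* Let $\alpha,\beta\in\mathbb{R}\setminus\mathbb{Q}$, and let $T_\alpha=\mathbb{R}/(\mathbb{Z}+\alpha\mathbb{Z})$ and $T_\beta=\mathbb{R}/(\mathbb{Z}+\beta\mathbb{Z})$ be the irrational tori with their quotient diffeologies. Then for any $x\in T_\alpha$ and $y\in T_\beta$, the $(T_\beta,y)$-internal tangent space of $(T_\alpha,x)$ satisfies $$T^{(T_\beta,y)}_x(T_\alpha)\cong\begin{cases}\mathbb{R}, & \text{if there exists a nonconstant smooth map } T_\alpha\to T_\beta,\\ 0, & \text{otherwise.}\end{cases}$$ Equivalently, $$T^{(T_\beta,y)}_x(T_\alpha)\cong\begin{cases}\mathbb{R}, & \text{if } \alpha=\dfrac{a+b\beta}{c+d\beta}\ \text{for some } a,b,c,d\in\mathbb{Z},\\ 0, & \text{otherwise.}\end{cases}$$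
   Context: Diffeological spaces. A parametrization of a set $X$ is a map $U\to X$ with $U$ an open subset of some $\mathbb{R}^n$, $n\ge 0$. A diffeology on $X$ is a set of parametrizations, called plots, such that: (Covering) every constant parametrization is a plot; (Locality) a parametrization $p:U\to X$ is a plot if $U$ has an open cover $\{U_i\}$ with every $p|_{U_i}$ a plot; (Smooth compatibility) if $p:U\to X$ is a plot, $V\subset\mathbb{R}^m$ is open and $f:V\to U$ is smooth, then $p\circ f$ is a plot. A diffeological space is a set with a diffeology. A map $f:X\to Y$ of diffeological spaces is smooth if $f\circ p$ is a plot of $Y$ for every plot $p$ of $X$. Smooth manifolds carry the standard diffeology (plots are the smooth maps from Euclidean open sets). The $D$-topology on $X$ is the finest topology making all plots continuous. For an equivalence relation $\sim$ on $X$, the quotient diffeology on $X/\!\sim$ consists of the parametrizations $p:U\to X/\!\sim$ such that each point of $U$ has a neighborhood $U'$ with $p|_{U'}=\pi\circ q$ for some plot $q:U'\to X$, where $\pi:X\to X/\!\sim$ is the quotient map. Categories. $\mathrm{Dflg}_*^{loc}$ is the category whose objects are based diffeological spaces $(X,x)$ and whose morphisms are germs at the basepoint (with respect to the $D$-topology) of basepoint-preserving smooth maps. $\mathrm{Eucl}_0^{loc}$ is its full subcategory on the pairs $(U,0)$ with $U$ an open subset of some $\mathbb{R}^n$ containing $0$. $\mathrm{Plots}(X,x)$ is the comma category $\mathrm{Eucl}_0^{loc}\downarrow(X,x)$: its objects are germs of plots $p:(U_p,0)\to(X,x)$ (so $p(0)=x$), and a morphism $p\to q$ is a morphism $f:(U_p,0)\to(U_q,0)$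 in $\mathrm{Eucl}_0^{loc}$ with $p=q\circ f$. Internal tangent space. For a based diffeological space $(X,x)$, $$T_x(X)=\Big(\bigoplus_{p\in\mathrm{Plots}(X,x)}T_0(U_p)\Big)\Big/R,$$ where $T_0(U_p)$ is the usual tangent space at $0$ and $R$ is the linear span of all $v-w$ with $v\in T_0(U_p)$, $w\in T_0(U_q)$ and $df_0(v)=w$ for some $f$ with $p=q\circ f$. The class of $v\in T_0(U_p)$ is denoted $[p,v]$. A germ $f:(X,x)\to(Y,y)$ in $\mathrm{Dflg}_*^{loc}$ induces the linear map $T(f):T_x(X)\to T_y(Y)$, $[p,v]\mapsto[f\circ p,v]$. $(Y,y)$-internal tangent space. For based diffeological spaces $(X,x)$ and $(Y,y)$, $$T^{(Y,y)}_x(X)=\Big(\bigoplus_{p\in\mathrm{Plots}(X,x)}T_0(U_p)\Big)\Big/R_{(Y,y)},$$ where $R_{(Y,y)}$ is the linear span of all $v-w$ with $v\in T_0(U_p)$, $w\in T_0(U_q)$ such that $T(f)[p,v]=T(f)[q,w]$ in $T_y(Y)$ for every morphism $f:(X,x)\to(Y,y)$ in $\mathrm{Dflg}_*^{loc}$. Irrational torus. For $\alpha\in\mathbb{R}\setminus\mathbb{Q}$, $T_\alpha=\mathbb{R}/(\mathbb{Z}+\alpha\mathbb{Z})$ (quotient of the additive group $\mathbb{R}$ by the subgroup $\mathbb{Z}+\alpha\mathbb{Z}$) with the quotient diffeology induced from the standard diffeology of $\mathbb{R}$. All vector spaces are real and $\cong$ means isomorphism of real vector spaces. *)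

(* Defs.v *)
From HB Require Import structures.
From mathcomp Require Import all_boot all_order all_algebra.
From mathcomp Require Import finmap.
From mathcomp Require Import all_classical all_reals all_analysis.
Set Implicit Arguments.
Unset Strict Implicit.
Unset Printing Implicit Defensive.
Import Order.TTheory GRing.Theory Num.Theory.
Import numFieldNormedType.Exports.
Local Open Scope classical_set_scope.
Local Open Scope ring_scope.
Local Open Scope quotient_scope.

(* C^k on an open set U of V: differentiable with C^(k-1) derivative in every
   direction; only meaningful for U open. *)
Fixpoint Ck (R : realType) (V W : normedModType R) (k : nat) (U : set V)
    (f : V -> W) : Prop :=
  match k with
  | 0 => forall x, U x -> {for x, continuous f}
  | k'.+1 => (forall x, U x -> differentiable f x) /\
             forall v, Ck k' U (fun x => 'D_v f x)
  end.

Definition smooth (R : realType) (V W : normedModType R) (U : set V)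
  (f : V -> W) : Prop := forall k, Ck k U f.

Section Smooth.
Variable R : realType.
Implicit Types (V W X : normedModType R).

Lemma near_diff V W (f g : V -> W) x :
  (\forall z \near x, f z = g z) -> differentiable f x ->
  differentiable g x /\ 'd g x = 'd f x :> (V -> W).
Proof.
move=> fg df.
have fgx : f x = g x := nbhs_singleton fg.
have E : g \o shift x = cst (g x) + 'd f x +o_ 0 id.
  apply/eqaddoP => e e0.
  have /eqaddoP/(_ _ e0) h := diff_locally df.
  have fg0 : \forall h \near (0:V), f (h + x) = g (h + x).
    by move: fg; rewrite (near_shift 0) /=; apply: filterS => y; rewrite /= subr0.
  near=> y.
  have : `|(f \o shift x - (cst (f x) + 'd f x)) y| <= e * `|id y| by near: y.
  rewrite !fctE /= /shift /=.
  have -> : f (y + x) = g (y + x) by near: y.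
  by rewrite fgx.
have dg := diff_unique (diff_continuous df) E.
split=> //; apply/diff_locallyP; split; first by rewrite dg; exact: diff_continuous.
by rewrite dg.
Unshelve. all: by end_near.
Qed.

Lemma open_near V W (U : set V) (f g : V -> W) x : open U ->
  (forall z, U z -> f z = g z) -> U x -> \forall z \near x, f z = g z.
Proof.
by move=> oU fg Ux; apply: filterS (open_nbhs_nbhs (conj oU Ux)).
Qed.

Lemma Ck_ext V W k (U : set V) (f g : V -> W) : open U ->
  (forall x, U x -> f x = g x) -> Ck k U f -> Ck k U g.
Proof.
move=> oU; elim: k f g => [|k IH] f g fg /= => [fc x Ux|[df Df]].
  have fgn := open_near oU fg Ux.
  rewrite /prop_for /continuous_at -(fg _ Ux).
  by apply: cvg_trans (fc _ Ux); apply: near_eq_cvg; apply: filterS fgn.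
split=> [x Ux|v]; first by have [] := near_diff (open_near oU fg Ux) (df _ Ux).
apply: IH (Df v) => x Ux; exact: near_eq_derive (open_near oU fg Ux).
Qed.

Lemma Ck_sub V W k (U U' : set V) (f : V -> W) :
  U' `<=` U -> Ck k U f -> Ck k U' f.
Proof.
move=> UU; elim: k f => [|k IH] f /= => [fc x /UU|[df Df]]; first exact: fc.
by split=> [x /UU|v]; [exact: df | exact: IH].
Qed.

Lemma CkS V W k (U : set V) (f : V -> W) : Ck k.+1 U f -> Ck k U f.
Proof.
elim: k f => [|k IH] f /= [df Df].
  by move=> x Ux; apply: differentiable_continuous; exact: df.
by split=> // v; apply: IH; exact: Df.
Qed.

Lemma Ck_open_cover V W k (U : set V) (f : V -> W) :
  (forall x, U x -> exists2 U', U' x & Ck k U' f) -> Ck k U f.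
Proof.
elim: k f => [|k IH] f H /=; first by move=> x /H [U' U'x]; exact.
split=> [x /H [U' U'x [h _]]|v]; first exact: h.
by apply: IH => x /H [U' U'x [_ h]]; exists U'; last exact: h.
Qed.

Lemma Ck_cst V W k (U : set V) (c : W) : Ck k U (fun=> c).
Proof.
elim: k c => [|k IH] c /=; first by move=> x _; exact: cst_continuous.
split=> [x _|v]; first exact: differentiable_cst.
have -> : (fun x => 'D_v (fun=> c) x) = (fun=> 0 : W).
  by apply/funext => x; exact: derive_cst.
exact: IH.
Qed.

Lemma Ck_lin V W X k (U : set V) (f : V -> W) (L : {linear W -> X}) :
  open U -> continuous L -> Ck k U f -> Ck k U (L \o f).
Proof.
move=> oU Lc; elim: k f => [|k IH] f /= => [fc x Ux|[df Df]].
  by apply: continuous_comp; [exact: fc | exact: Lc].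
have dL z : differentiable L z by exact: linear_differentiable.
split=> [x Ux|v]; first by apply: differentiable_comp; [exact: df | exact: dL].
apply: Ck_ext oU _ (IH _ (Df v)) => x Ux /=.
have dfx := df _ Ux; have dLf := differentiable_comp dfx (dL (f x)).
rewrite (deriveE _ dfx) (deriveE _ dLf) (diff_comp dfx (dL (f x))) /=.
by rewrite (diff_lin _ Lc).
Qed.

Lemma CkD V W k (U : set V) (f g : V -> W) : open U ->
  Ck k U f -> Ck k U g -> Ck k U (f \+ g).
Proof.
move=> oU; elim: k f g => [|k IH] f g /= => [fc gc x Ux|[df Df] [dg Dg]].
  by apply: cvgD; [exact: fc | exact: gc].
split=> [x Ux|v]; first by apply: differentiableD; [exact: df | exact: dg].
apply: Ck_ext oU _ (IH _ _ (Df v) (Dg v)) => x Ux /=.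
by rewrite deriveD //; apply: diff_derivable; [exact: df | exact: dg].
Qed.

Lemma Ck_sum V W k (U : set V) (I : Type) (r : seq I) (f : I -> V -> W) :
  open U -> (forall i, Ck k U (f i)) ->
  Ck k U (fun x => \sum_(i <- r) f i x).
Proof.
move=> oU cf; elim: r => [|i r IH].
  apply: Ck_ext oU _ (Ck_cst k U 0) => x _; by rewrite big_nil.
by apply: Ck_ext oU _ (CkD oU (cf i) IH) => x _; rewrite big_cons.
Qed.

Fact scale_is_bilinear W :
  bilinear_for
    (GRing.Scale.Law.clone _ _ *:%R _) (GRing.Scale.Law.clone _ _ *:%R _)
    (@GRing.scale R W : R^o -> W -> W).
Proof.
split=> [u'|u] a x y /=; first by rewrite scalerDl scalerA.
by rewrite scalerDr !scalerA mulrC.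
Qed.
HB.instance Definition _ W := bilinear_isBilinear.Build R R^o W W _ _
  (@GRing.scale R W : R^o -> W -> W) (@scale_is_bilinear W).

Lemma diff_scale V W (a : V -> R^o) (f : V -> W) x :
  differentiable a x -> differentiable f x ->
  differentiable (fun x => a x *: f x) x /\
  forall v, 'D_v (fun x => a x *: f x) x = a x *: 'D_v f x + 'D_v a x *: f x.
Proof.
move=> da df.
have sc (p : R^o * W) : {for p, continuous (fun p : R^o * W => p.1 *: p.2)}.
  exact: scale_continuous.
pose B : {bilinear R^o -> W -> W} := (@GRing.scale R W : R^o -> W -> W).
have dB (p : R^o * W) : differentiable (fun p : R^o * W => p.1 *: p.2) p.
  exact: (@differentiable_bilin _ _ _ _ B p scale_continuous).
have dp : differentiable (fun x => (a x, f x)) x by exact: differentiable_pair.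
have ds : differentiable (fun x => a x *: f x) x.
  exact: (differentiable_comp dp (dB _)).
split=> // v; rewrite !deriveE //.
have := diff_comp dp (dB (a x, f x)); rewrite /comp /= => ->.
by rewrite (@diff_bilin _ _ _ _ B _ scale_continuous) diff_pair.
Qed.

Lemma Ck_scale V W k (U : set V) (a : V -> R^o) (f : V -> W) : open U ->
  Ck k U a -> Ck k U f -> Ck k U (fun x => a x *: f x).
Proof.
move=> oU; elim: k a f => [|k IH] a f => [ac fc x Ux|ca cf].
  by apply: cvgZ; [exact: ac | exact: fc].
have [[da Da] [df Df]] := (ca, cf).
split=> [x Ux|v]; first by have [] := diff_scale (da _ Ux) (df _ Ux).
have := CkD oU (IH _ _ (CkS ca) (Df v)) (IH _ _ (Da v) (CkS cf)).
apply: (Ck_ext oU) => x Ux.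
by have [_ /(_ v) ->] := diff_scale (da _ Ux) (df _ Ux).
Qed.

Definition coordv n (j : 'I_n) (v : 'rV[R]_n) : R^o := v 0 j.

Lemma coordv_continuous n (j : 'I_n) : continuous (coordv j).
Proof.
by move=> v; apply: differentiable_continuous; exact: differentiable_coord.
Qed.

Fact coordv_is_linear n (j : 'I_n) : linear (@coordv n j).
Proof. by move=> a u v; rewrite /coordv !mxE. Qed.
HB.instance Definition _ n (j : 'I_n) :=
  GRing.isLinear.Build R 'rV[R]_n R^o _ (@coordv n j) (@coordv_is_linear n j).

Lemma Ck_comp m n W k (U : set 'rV[R]_n) (V : set 'rV[R]_m)
    (g : 'rV[R]_n -> W) (f : 'rV[R]_m -> 'rV[R]_n) :
  open V -> (forall x, V x -> U (f x)) ->
  Ck k U g -> Ck k V f -> Ck k V (g \o f).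
Proof.
move=> oV VU; elim: k g => [|k IH] g => [gc fc x Vx|[dg Dg] cf].
  by apply: continuous_comp; [exact: fc | exact/gc/VU].
have [df Df] := cf.
split=> [x Vx|v]; first by apply: differentiable_comp; [exact: df | exact/dg/VU].
pose h (j : 'I_n) x := ('D_v f x) 0 j *: 'D_(delta_mx 0 j) g (f x).
apply: (@Ck_ext _ _ _ _ (fun x => \sum_j h j x)) => // [x Vx|].
  have dfx := df _ Vx; have dgx := dg _ (VU _ Vx).
  rewrite (deriveE _ (differentiable_comp dfx dgx)) (diff_comp dfx dgx) /=.
  rewrite -(deriveE _ dfx).
  rewrite [in RHS](row_sum_delta ('D_v f x)) linear_sum; apply: eq_bigr => j _.
  by rewrite linearZ /h (deriveE _ dgx).
apply: Ck_sum => // j; apply: Ck_scale => //; last exact: IH (Dg _) (CkS cf).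
exact: (Ck_lin oV (@coordv_continuous n j) (Df v)).
Qed.

Lemma smooth_id V (U : set V) : smooth U (idfun : V -> V).
Proof.
case=> [|k] /=; first by move=> x _; exact: cvg_id.
split=> [x _|v]; first by apply: (@linear_differentiable _ _ _ idfun) => y; exact: cvg_id.
have -> : (fun x : V => 'D_v idfun x) = (fun=> v).
  by apply/funext => x; exact: derive_id.
exact: Ck_cst.
Qed.

Lemma open_preim V W (U : set V) (U' : set W) (f : V -> W) :
  open U -> open U' -> Ck 0 U f -> open (U `&` f @^-1` U').
Proof.
move=> oU oU' cf; rewrite openE => x [Ux U'fx].
apply: filterI; first exact: open_nbhs_nbhs.
exact: cf (open_nbhs_nbhs (conj oU' U'fx)).
Qed.

End Smooth.

Section DirectSum.
Variables (R : pzRingType) (I : choiceType) (V : I -> lmodType R).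

Record dsum := DSum {
  dsum_fun :> forall i, V i;
  dsum_finite : finite_set [set i | dsum_fun i != 0] }.

HB.instance Definition _ := gen_eqMixin dsum.
HB.instance Definition _ := gen_choiceMixin dsum.

Implicit Types f g : dsum.

Lemma dsumP f g : (forall i, f i = g i) -> f = g.
Proof.
case: f g => [f ff] [g gf] /= fg.
have E : f = g by apply: functional_extensionality_dep.
by rewrite E in ff *; congr DSum; exact: Prop_irrelevance.
Qed.

Fact dsum0_subproof : finite_set [set i | (fun i => 0 : V i) i != 0].
Proof. by apply: (sub_finite_set _ (finite_set0 I)) => i /=; rewrite eqxx. Qed.
Definition dsum0 := DSum dsum0_subproof.

Fact dsumN_subproof f : finite_set [set i | (fun i => - f i) i != 0].
Proof.
by apply: (sub_finite_set _ (dsum_finite f)) => i /=; rewrite oppr_eq0.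
Qed.
Definition dsumN f := DSum (dsumN_subproof f).

Fact dsumD_subproof f g : finite_set [set i | (fun i => f i + g i) i != 0].
Proof.
have : finite_set ([set i | f i != 0] `|` [set i | g i != 0]).
  by rewrite finite_setU; split; exact: dsum_finite.
apply: sub_finite_set => i /=; apply: contraNP => /not_orP[].
by move=> /negP/negPn/eqP -> /negP/negPn/eqP ->; rewrite addr0.
Qed.
Definition dsumD f g := DSum (dsumD_subproof f g).

Fact dsumZ_subproof (a : R) f : finite_set [set i | (fun i => a *: f i) i != 0].
Proof.
apply: (sub_finite_set _ (dsum_finite f)) => i /=.
by apply: contra_neq => ->; rewrite scaler0.
Qed.
Definition dsumZ a f := DSum (dsumZ_subproof a f).

Fact dsumDA : associative dsumD.
Proof. by move=> f g h; apply: dsumP => i /=; rewrite addrA. Qed.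
Fact dsumDC : commutative dsumD.
Proof. by move=> f g; apply: dsumP => i /=; rewrite addrC. Qed.
Fact dsum0D : left_id dsum0 dsumD.
Proof. by move=> f; apply: dsumP => i /=; rewrite add0r. Qed.
Fact dsumND : left_inverse dsum0 dsumN dsumD.
Proof. by move=> f; apply: dsumP => i /=; rewrite addNr. Qed.
HB.instance Definition _ :=
  GRing.isZmodule.Build dsum dsumDA dsumDC dsum0D dsumND.

Fact dsumZA a b f : dsumZ a (dsumZ b f) = dsumZ (a * b) f.
Proof. by apply: dsumP => i /=; rewrite scalerA. Qed.
Fact dsum1Z : left_id 1 dsumZ.
Proof. by move=> f; apply: dsumP => i /=; rewrite scale1r. Qed.
Fact dsumZDr : right_distributive dsumZ +%R.
Proof. by move=> a f g; apply: dsumP => i /=; rewrite scalerDr. Qed.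
Fact dsumZDl f : {morph dsumZ^~ f : a b / a + b}.
Proof. by move=> a b; apply: dsumP => i /=; rewrite scalerDl. Qed.
HB.instance Definition _ :=
  GRing.Zmodule_isLmodule.Build R dsum dsumZA dsum1Z dsumZDr dsumZDl.

Fact dsum_in_subproof (i : I) (v : V i) :
  finite_set [set j | @eqtype.dfwith I (fun k => V k) (fun k => 0) i v j != 0].
Proof.
apply: (sub_finite_set _ (finite_set1 i)) => j /=.
by apply: contraNP => /eqP ij; rewrite dfwith_out // eq_sym.
Qed.
Definition dsum_in (i : I) (v : V i) : dsum := DSum (dsum_in_subproof v).

Fact dsum_in_is_linear i : linear (@dsum_in i).
Proof.
move=> a u v; apply: dsumP => j /=.
have [ij|ij] := eqVneq i j.
  by subst j; rewrite !dfwith_in.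
by rewrite !dfwith_out // scaler0 addr0.
Qed.
HB.instance Definition _ i :=
  GRing.isLinear.Build R (V i) dsum _ (@dsum_in i) (@dsum_in_is_linear i).

Section Lift.
Variables (W : lmodType R) (g : forall i, {linear V i -> W}).

Definition dsum_lift (f : dsum) : W := \sum_(i \in [set: I]) g i (f i).

Lemma dsum_lift_supp f (A : set I) : finite_set A ->
  (forall i, f i != 0 -> A i) -> dsum_lift f = \sum_(i <- fset_set A) g i (f i).
Proof.
move=> fA sA; rewrite /dsum_lift -fsbig_finite //.
symmetry; apply: fsbig_widen => // i [_ /= nA].
by have [->|/sA //] := eqVneq (f i) 0; rewrite linear0.
Qed.

Fact dsum_lift_is_linear : linear dsum_lift.
Proof.
move=> a u v.
pose A : set I := [set i | u i != 0] `|` [set i | v i != 0].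
have fA : finite_set A by rewrite finite_setU; split; exact: dsum_finite.
rewrite !(@dsum_lift_supp _ A) //; last first.
- move=> i /=; apply: contraNP => /not_orP[].
  by move=> /negP/negPn/eqP -> /negP/negPn/eqP ->; rewrite scaler0 addr0.
- by move=> i ?; left.
- by move=> i ?; right.
rewrite scaler_sumr -big_split /=; apply: eq_bigr => i _.
by rewrite linearD linearZ.
Qed.
HB.instance Definition _ :=
  GRing.isLinear.Build R dsum W _ dsum_lift dsum_lift_is_linear.

Lemma dsum_lift_in i (v : V i) : dsum_lift (dsum_in v) = g i v.
Proof.
rewrite (@dsum_lift_supp _ [set i]); last 2 first.
- exact: finite_set1.
- by move=> j /=; apply: contraNP => /eqP ij; rewrite dfwith_out // eq_sym.
by rewrite fset_set1 big_seq_fset1 /= dfwith_in.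
Qed.

End Lift.
End DirectSum.

Section QuotientModule.
Variables (R : pzRingType) (V : lmodType R).

Definition lspan (S : set V) : set V :=
  [set v | exists2 s : seq (R * V), forall p, p \in s -> S p.2 &
           v = \sum_(p <- s) p.1 *: p.2].

Variable S : set V.

Lemma lspan_submod : submod_closed (mem (lspan S)).
Proof.
split; first by rewrite inE; exists [::] => //; rewrite big_nil.
move=> a u v; rewrite !inE => -[s sS ->] [t tS ->].
exists ([seq (a * p.1, p.2) | p <- s] ++ t).
  move=> p; rewrite mem_cat => /orP[/mapP[q qs ->]|/tS //]; exact: (sS _ qs).
rewrite big_cat big_map scaler_sumr; congr (_ + _).
by apply: eq_bigr => p _; rewrite scalerA.
Qed.

Lemma sub_lspan v : S v -> lspan S v.
Proof.
by move=> Sv; exists [:: (1, v)] => [p|]; rewrite ?big_seq1 ?scale1r // inE => /eqP ->.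
Qed.

Definition lspan_pred : {pred V} := mem (lspan S).
HB.instance Definition _ := GRing.isSubmodClosed.Build R V lspan_pred lspan_submod.

Definition quotmod := Quotient.quot lspan_pred.
HB.instance Definition _ := GRing.Zmodule.on quotmod.

Definition qclass (v : V) : quotmod := \pi_(Quotient.quot lspan_pred) v.

Lemma qclassP u v : qclass u = qclass v <-> lspan S (u - v).
Proof.
have := Quotient.idealrBE lspan_pred u v.
rewrite [_ \in _](_ : _ = ((u - v) \in lspan S)) // => E.
split=> [/eqP|h]; first by rewrite -E inE.
by apply/eqP; rewrite -E inE.
Qed.

Lemma qclass_repr (x : quotmod) : qclass (repr x) = x.
Proof. exact: reprK. Qed.

Fact qclassD : {morph qclass : u v / u + v}.
Proof. exact: Quotient.pi_add. Qed.

Definition quotmod_scale (a : R) (x : quotmod) : quotmod := qclass (a *: repr x).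

Lemma quotmod_scaleE a v : quotmod_scale a (qclass v) = qclass (a *: v).
Proof.
apply/qclassP; rewrite -scalerBr; have /qclassP := qclass_repr (qclass v).
move=> h; have [_ /(_ a)] := lspan_submod.
move=> /(_ (repr (qclass v) - v) 0); rewrite addr0 !inE; apply=> //.
by have [] := lspan_submod; rewrite inE.
Qed.

Fact quotmodZA a b x :
  quotmod_scale a (quotmod_scale b x) = quotmod_scale (a * b) x.
Proof. by rewrite -[x]qclass_repr !quotmod_scaleE scalerA. Qed.
Fact quotmod1Z : left_id 1 quotmod_scale.
Proof. by move=> x; rewrite -[x]qclass_repr quotmod_scaleE scale1r. Qed.
Fact quotmodZDr : right_distributive quotmod_scale +%R.
Proof.
move=> a x y; rewrite -[x]qclass_repr -[y]qclass_repr -qclassD !quotmod_scaleE.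
by rewrite scalerDr qclassD.
Qed.
Fact quotmodZDl x : {morph quotmod_scale^~ x : a b / a + b}.
Proof.
move=> a b; rewrite -[x]qclass_repr !quotmod_scaleE -qclassD.
by rewrite scalerDl.
Qed.
HB.instance Definition _ := GRing.Zmodule_isLmodule.Build R quotmod
  quotmodZA quotmod1Z quotmodZDr quotmodZDl.

Fact qclass_is_linear : linear qclass.
Proof. by move=> a u v; rewrite qclassD -quotmod_scaleE. Qed.
HB.instance Definition _ :=
  GRing.isLinear.Build R V quotmod _ qclass qclass_is_linear.

Section Lift.
Variables (W : lmodType R) (f : {linear V -> W}).

Definition qlift (x : quotmod) : W := f (repr x).

Hypothesis fS : forall s, S s -> f s = 0.

Lemma qlift_class v : qlift (qclass v) = f v.
Proof.
have /qclassP [s sS e] := qclass_repr (qclass v).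
apply/eqP; rewrite -subr_eq0 /qlift -linearB e linear_sum big_seq big1 //.
by move=> p /sS pS; rewrite linearZ /= fS // scaler0.
Qed.

Lemma qlift_is_linear : linear qlift.
Proof.
move=> a x y; rewrite -[x]qclass_repr -[y]qclass_repr -linearP !qlift_class.
by rewrite linearP.
Qed.
End Lift.
End QuotientModule.

Definition lmod_iso (R : pzRingType) (V W : lmodType R) : Prop :=
  exists f : {linear V -> W}, bijective f.

(* A parametrization U -> X is encoded as a total function on R^n together
   with its domain U; ds_ext makes values outside U irrelevant. *)
Record diffSpace (R : realType) := DiffSpace {
  ds_carrier :> Type;
  isplot : forall n, set 'rV[R]_n -> ('rV[R]_n -> ds_carrier) -> Prop;
  ds_open : forall n (U : set 'rV[R]_n) p, isplot U p -> open U;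
  ds_ext : forall n (U : set 'rV[R]_n) p q,
    (forall u, U u -> p u = q u) -> isplot U p -> isplot U q;
  ds_cover : forall n (U : set 'rV[R]_n) x, open U -> isplot U (fun=> x);
  ds_local : forall n (U : set 'rV[R]_n) p (C : set (set 'rV[R]_n)),
    C `<=` open -> \bigcup_(V in C) V = U ->
    (forall V, C V -> isplot V p) -> isplot U p;
  ds_smooth : forall n m (U : set 'rV[R]_n) (V : set 'rV[R]_m) p f,
    isplot U p -> open V -> (forall v, V v -> U (f v)) -> smooth V f ->
    isplot V (p \o f) }.

Section Diffeology.
Variable R : realType.
Implicit Types X Y : diffSpace R.

Definition dsmooth X Y (f : X -> Y) : Prop :=
  forall n (U : set 'rV[R]_n) p, isplot U p -> isplot U (f \o p).

(* the final topology of the plots, i.e. the finest one making them continuous *)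
Definition Dopen X (A : set X) : Prop :=
  forall n (U : set 'rV[R]_n) p, isplot U p -> open (U `&` p @^-1` A).

(* smoothness of the restriction of f to A: the plots of A are the plots of X
   with values in A *)
Definition dsmooth_on X Y (A : set X) (f : X -> Y) : Prop :=
  forall n (U : set 'rV[R]_n) p,
    isplot U p -> (forall u, U u -> A (p u)) -> isplot U (f \o p).

Lemma isplot_sub X n (U U' : set 'rV[R]_n) (p : 'rV[R]_n -> X) :
  open U' -> U' `<=` U -> isplot U p -> isplot U' p.
Proof.
by move=> oU' UU' pp; exact: ds_smooth pp oU' UU' (@smooth_id _ _ U').
Qed.

Section InducedDiffeology.
Variables (T : Type) (W : normedModType R) (i : T -> W).

Definition ind_plot n (U : set 'rV[R]_n) (p : 'rV[R]_n -> T) : Prop :=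
  open U /\ smooth U (i \o p).

Fact ind_open n (U : set 'rV[R]_n) p : ind_plot U p -> open U.
Proof. by case. Qed.

Fact ind_ext n (U : set 'rV[R]_n) p q :
  (forall u, U u -> p u = q u) -> ind_plot U p -> ind_plot U q.
Proof.
move=> pq [oU sp]; split=> // k; apply: Ck_ext (sp k) => // u Uu.
by rewrite /= pq.
Qed.

Fact ind_cover n (U : set 'rV[R]_n) x : open U -> ind_plot U (fun=> x).
Proof. by move=> oU; split=> // k; exact: Ck_cst. Qed.

Fact ind_local n (U : set 'rV[R]_n) p (C : set (set 'rV[R]_n)) :
  C `<=` open -> \bigcup_(V in C) V = U ->
  (forall V, C V -> ind_plot V p) -> ind_plot U p.
Proof.
move=> oC <- H; split; first exact: bigcup_open.
move=> k; apply: Ck_open_cover => u [V CV Vu]; exists V => //.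
by have [_] := H _ CV.
Qed.

Fact ind_smooth n m (U : set 'rV[R]_n) (V : set 'rV[R]_m) p f :
  ind_plot U p -> open V -> (forall v, V v -> U (f v)) -> smooth V f ->
  ind_plot V (p \o f).
Proof.
move=> [oU sp] oV VU sf; split=> // k.
exact: (Ck_comp (g := i \o p) oV VU (sp k) (sf k)).
Qed.

Definition ind_space : diffSpace R :=
  DiffSpace ind_open ind_ext ind_cover ind_local ind_smooth.
End InducedDiffeology.
Definition open_space n (U : set 'rV[R]_n) : diffSpace R :=
  ind_space (set_val : set_type U -> 'rV[R]_n).
Definition real_line : diffSpace R := ind_space (idfun : R -> R^o).

Section QuotientDiffeology.
Variables (X : diffSpace R) (e : equiv_rel {classic X}).

Definition quot_plot n (U : set 'rV[R]_n) (p : 'rV[R]_n -> {eq_quot e}) : Prop :=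
  open U /\ forall u, U u -> exists (U' : set 'rV[R]_n) (q : 'rV[R]_n -> X),
    [/\ U' u, U' `<=` U, isplot U' q &
        forall z, U' z -> p z = \pi_({eq_quot e}) (q z : {classic X})].

Fact quot_open n (U : set 'rV[R]_n) p : quot_plot U p -> open U.
Proof. by case. Qed.

Fact quot_ext n (U : set 'rV[R]_n) p q :
  (forall u, U u -> p u = q u) -> quot_plot U p -> quot_plot U q.
Proof.
move=> pq [oU H]; split=> // u /H [U' [r [U'u UU' pr E]]].
by exists U', r; split=> // z U'z; rewrite -pq ?E //; exact: UU'.
Qed.

Fact quot_cover n (U : set 'rV[R]_n) x : open U -> quot_plot U (fun=> x).
Proof.
move=> oU; split=> // u Uu; exists U, (fun=> repr x).
by split=> //; [exact: ds_cover | move=> z _; rewrite reprK].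
Qed.

Fact quot_local n (U : set 'rV[R]_n) p (C : set (set 'rV[R]_n)) :
  C `<=` open -> \bigcup_(V in C) V = U ->
  (forall V, C V -> quot_plot V p) -> quot_plot U p.
Proof.
move=> oC <- H; split; first exact: bigcup_open.
move=> u [V CV Vu]; have [_ /(_ _ Vu)[U' [q [U'u UV pq E]]]] := H _ CV.
by exists U', q; split=> // z /UV Vz; exists V.
Qed.

Fact quot_smooth n m (U : set 'rV[R]_n) (V : set 'rV[R]_m) p f :
  quot_plot U p -> open V -> (forall v, V v -> U (f v)) -> smooth V f ->
  quot_plot V (p \o f).
Proof.
move=> [oU H] oV VU sf; split=> // v Vv.
have [U' [q [U'fv UU' pq E]]] := H _ (VU _ Vv).
have oU' := ds_open pq.
pose V' := V `&` f @^-1` U'.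
have oV' : open V' by exact: open_preim oV oU' (sf 0).
exists V', (q \o f); split=> //; [by move=> z []| |by move=> z [_ /= /E]].
apply: ds_smooth pq oV' _ _ => [z []|k] //.
by apply: Ck_sub (sf k) => z [].
Qed.

Definition quot_space : diffSpace R :=
  DiffSpace quot_open quot_ext quot_cover quot_local quot_smooth.
End QuotientDiffeology.
End Diffeology.

Record based (R : realType) := Based {
  bspace :> diffSpace R;
  bpt : bspace }.

Section Germs.
Variable R : realType.
Implicit Types X Y Z : based R.

(* Representatives of germs at x of smooth maps (X,x) -> (Y,y): smoothness is
   only required on some D-open neighbourhood of x, the values elsewhere being
   irrelevant. *)
Record locmap X Y := LocMap {
  lm_fun :> X -> Y;
  lm_pt : lm_fun (bpt X) = bpt Y;
  lm_smooth : exists A : set X, [/\ Dopen A, A (bpt X) & dsmooth_on A lm_fun] }.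

Definition germ_rel X Y (f g : {classic locmap X Y}) : bool :=
  `[< exists A : set X, [/\ Dopen A, A (bpt X) &
        forall z, A z -> (f : locmap X Y) z = (g : locmap X Y) z] >].

Lemma DopenI (S : diffSpace R) (A B : set S) :
  Dopen A -> Dopen B -> Dopen (A `&` B).
Proof.
move=> oA oB n U p pp; have := openI (oA _ _ _ pp) (oB _ _ _ pp).
by rewrite preimage_setI setIACA setIid.
Qed.

Fact germ_rel_refl X Y : reflexive (@germ_rel X Y).
Proof.
move=> f; apply/asboolP; have [A [oA Ax _]] := lm_smooth f.
by exists A; split.
Qed.
Fact germ_rel_sym X Y : symmetric (@germ_rel X Y).
Proof.
move=> f g; apply: asbool_equiv_eq.
by split=> -[A [oA Ax E]]; exists A; split=> // z /E.
Qed.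
Fact germ_rel_trans X Y : transitive (@germ_rel X Y).
Proof.
move=> g f h /asboolP[A [oA Ax E]] /asboolP[B [oB Bx F]]; apply/asboolP.
exists (A `&` B); split; [exact: DopenI | by split |].
by move=> z [Az Bz]; rewrite E ?F.
Qed.
Canonical germ_equiv X Y := EquivRel (@germ_rel X Y)
  (@germ_rel_refl X Y) (@germ_rel_sym X Y) (@germ_rel_trans X Y).

Definition germ X Y := {eq_quot (@germ_equiv X Y)}.
HB.instance Definition _ X Y := Choice.on (germ X Y).

Definition to_germ X Y (f : locmap X Y) : germ X Y :=
  \pi_({eq_quot (@germ_equiv X Y)}) (f : {classic locmap X Y}).
Definition germ_rep X Y (f : germ X Y) : locmap X Y := repr f.

Lemma germ_repK X Y (f : germ X Y) : to_germ (germ_rep f) = f.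
Proof. exact: reprK. Qed.

Lemma to_germP X Y (f g : locmap X Y) : to_germ f = to_germ g <->
  exists A : set X, [/\ Dopen A, A (bpt X) & forall z, A z -> f z = g z].
Proof.
split=> [/eqquotP/asboolP//|h]; apply/eqquotP; exact/asboolP.
Qed.

Lemma Dopen_preim X Y (f : X -> Y) (A : set X) (B : set Y) :
  Dopen A -> dsmooth_on A f -> Dopen B -> Dopen (A `&` f @^-1` B).
Proof.
move=> oA sf oB n U p pp.
have oU := oA _ _ _ pp.
have pU := isplot_sub oU (@subIsetl _ _ _) pp.
have fp := sf _ _ _ pU (fun u (h : (U `&` p @^-1` A) u) => h.2).
by have := oB _ _ _ fp; rewrite preimage_setI setIA.
Qed.

Fact locmap_comp_subproof X Y Z (g : locmap Y Z) (f : locmap X Y) :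
  (g \o f) (bpt X) = bpt Z /\
  exists A : set X, [/\ Dopen A, A (bpt X) & dsmooth_on A (g \o f)].
Proof.
split; first by rewrite /= !lm_pt.
have [A [oA Ax sf]] := lm_smooth f; have [B [oB By sg]] := lm_smooth g.
exists (A `&` f @^-1` B); split; first exact: Dopen_preim.
  by split=> //=; rewrite lm_pt.
move=> n U p pp UAB; rewrite -compA; apply: sg.
  by apply: sf => // u /UAB[].
by move=> u /UAB[].
Qed.
Definition locmap_comp X Y Z (g : locmap Y Z) (f : locmap X Y) : locmap X Z :=
  LocMap (locmap_comp_subproof g f).1 (locmap_comp_subproof g f).2.

Definition germ_comp X Y Z (g : germ Y Z) (f : germ X Y) : germ X Z :=
  to_germ (locmap_comp (germ_rep g) (germ_rep f)).

Lemma germ_compE X Y Z (g : locmap Y Z) (f : locmap X Y) :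
  germ_comp (to_germ g) (to_germ f) = to_germ (locmap_comp g f).
Proof.
have /to_germP[A [oA Ax fE]] := germ_repK (to_germ f).
have /to_germP[B [oB By gE]] := germ_repK (to_germ g).
have [C [oC Cx sf]] := lm_smooth f.
apply/to_germP; exists (A `&` (C `&` f @^-1` B)).
split; first by apply: DopenI => //; exact: Dopen_preim.
  by split=> //; split=> //=; rewrite lm_pt.
by move=> z [Az [Cz Bfz]] /=; rewrite fE // gE.
Qed.

Lemma germ_compA X Y Z (W : based R) (h : germ Z W) (g : germ Y Z) (f : germ X Y) :
  germ_comp h (germ_comp g f) = germ_comp (germ_comp h g) f.
Proof.
rewrite -[h]germ_repK -[g]germ_repK -[f]germ_repK !germ_compE.
by apply/to_germP; have [A [oA Ax _]] := lm_smooth (germ_rep f); exists A.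
Qed.

End Germs.

Section InternalTangentSpace.
Variable R : realType.

Record eucl := Eucl {
  edim : nat;
  edom : set 'rV[R]_edim;
  edom_open : open edom;
  edom0 : edom 0 }.
Arguments edom : clear implicits.

Definition eucl_based (E : eucl) : based R :=
  @Based R (open_space (edom E)) (SigSub (mem_set (edom0 E))).
Local Coercion eucl_based : eucl >-> based.

(* df_0 : R^n -> R^m for a germ f : (U,0) -> (V,0), computed on a representative
   extended by 0 outside U *)
Definition germ_diff (E F : eucl) (f : germ E F) :
    'rV[R]_(edim E) -> 'rV[R]_(edim F) :=
  'd (valL_ (0 : 'rV[R]_(edim F)) (set_val \o germ_rep f)) (0 : 'rV[R]_(edim E)).

Definition eucl_proj (E : eucl) (z : 'rV[R]_(edim E)) : set_type (edom E) :=
  insubd (SigSub (mem_set (edom0 E))) z.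
Arguments eucl_proj : clear implicits.

Lemma eucl_projK (E : eucl) z : edom E z -> set_val (eucl_proj E z) = z.
Proof. by move=> Ez; rewrite set_valE /eucl_proj insubdK // inE. Qed.

Lemma eucl_proj_val (E : eucl) (x : set_type (edom E)) :
  eucl_proj E (set_val x) = x.
Proof. by apply: val_inj; rewrite -set_valE eucl_projK //; exact: set_valP. Qed.

Lemma eucl_proj_plot (E : eucl) :
  @isplot _ (open_space (edom E)) _ (edom E) (eucl_proj E).
Proof.
split; first exact: edom_open.
move=> k; apply: Ck_ext (@smooth_id _ _ _ k); first exact: edom_open.
by move=> x Ex; rewrite /= eucl_projK.
Qed.

Lemma valL_edom (E : eucl) T (c : T) (h : set_type (edom E) -> T) z :
  edom E z -> valL_ c h z = h (eucl_proj E z).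
Proof.
move=> Ez; rewrite /valL_ oinv_set_val /= insubT ?inE // => Ez' /=; congr h.
by apply: val_inj; have := eucl_projK Ez; rewrite set_valE => ->.
Qed.

Lemma locmap_smooth_near (E F : eucl) (f : locmap E F) :
  exists V : set 'rV[R]_(edim E), [/\ open V, V 0, V `<=` edom E &
    smooth V (valL_ (0 : 'rV[R]_(edim F)) (set_val \o f))].
Proof.
have [A [oA A0 sf]] := lm_smooth f.
pose V := edom E `&` eucl_proj E @^-1` A.
have oV : open V by apply: oA; exact: eucl_proj_plot.
have V0 : V 0.
  by split; [exact: edom0 | rewrite /= -[0]/(set_val (bpt E)) eucl_proj_val].
have pV := isplot_sub oV (@subIsetl _ _ _) (eucl_proj_plot E).
have [_ sm] : ind_plot (set_val : set_type (edom F) -> 'rV[R]_(edim F)) V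
    (f \o eucl_proj E) := sf _ _ _ pV (fun u (h : V u) => h.2).
exists V; split=> // [|k]; first exact: subIsetl.
apply: (Ck_ext oV _ (sm k)) => x Vx; rewrite valL_edom //.
by case: Vx.
Qed.

Lemma germ_diffE (E F : eucl) (f : locmap E F) :
  germ_diff (to_germ f) =
  'd (valL_ (0 : 'rV[R]_(edim F)) (set_val \o f)) (0 : 'rV[R]_(edim E))
  :> (_ -> _).
Proof.
have /to_germP[A [oA A0 gf]] := germ_repK (to_germ f).
have [V [oV V0 VE sf]] := locmap_smooth_near f.
have oU : open (edom E `&` eucl_proj E @^-1` A) by apply: oA; exact: eucl_proj_plot.
have fg : \forall z \near (0 : 'rV[R]_(edim E)), valL_ 0 (set_val \o f) z =
    valL_ (0 : 'rV[R]_(edim F)) (set_val \o germ_rep (to_germ f)) z.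
  apply: open_near oU _ _ => [z [Ez Az]|]; first by rewrite !(valL_edom _ _ Ez) /= gf.
  by split; [exact: edom0 | rewrite /= -[0]/(set_val (bpt E)) eucl_proj_val].
by have [] := near_diff fg ((sf 1%N).1 _ V0).
Qed.

(* The comma category Eucl_0^loc over (X,x); smooth maps out of the diffeological
   space U are exactly its plots with domain U. *)
Record plots (X : based R) := Plot { pdom : eucl; pgerm : germ pdom X }.
HB.instance Definition _ X := gen_eqMixin (plots X).
HB.instance Definition _ X := gen_choiceMixin (plots X).

Definition T0 (X : based R) (p : plots X) : lmodType R := 'rV[R]_(edim (pdom p)).

Definition plots_sum (X : based R) : lmodType R := dsum (@T0 X).

Definition tangent_rel (X : based R) : set (plots_sum X) :=
  [set u | exists (p q : plots X) (f : germ (pdom p) (pdom q)) (v : T0 p) (w : T0 q),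
     [/\ pgerm p = germ_comp (pgerm q) f, germ_diff f v = w &
         u = dsum_in v - dsum_in w]].

Definition tangent (X : based R) : lmodType R := quotmod (@tangent_rel X).

Definition tclass (X : based R) (p : plots X) (v : T0 p) : tangent X :=
  qclass (@tangent_rel X) (dsum_in v).

Definition plots_comp (X Y : based R) (f : germ X Y) (p : plots X) : plots Y :=
  Plot (germ_comp f (pgerm p)).


Section TangentMap.
Variables (X Y : based R) (f : germ X Y).

Definition tmap_at (p : plots X) (v : T0 p) : tangent Y :=
  @tclass Y (plots_comp f p) v.

Fact tmap_at_is_linear (p : plots X) : linear (@tmap_at p).
Proof. by move=> a u v; rewrite /tmap_at /tclass !linearP. Qed.
HB.instance Definition _ (p : plots X) :=
  GRing.isLinear.Build R (T0 p) (tangent Y) _ (@tmap_at p)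
    (@tmap_at_is_linear p).

Definition tmap_sum : {linear plots_sum X -> tangent Y} :=
  dsum_lift (fun p => @tmap_at p : {linear T0 p -> tangent Y}).

Fact tmap_sum_rel s : tangent_rel s -> tmap_sum s = 0.
Proof.
move=> [p [q [g [v [w [E dg ->]]]]]].
rewrite linearB /= !dsum_lift_in; apply/eqP; rewrite subr_eq0; apply/eqP.
apply/qclassP/sub_lspan.
exists (plots_comp f p), (plots_comp f q), g, v, w; split=> //=.
by rewrite E germ_compA.
Qed.

Definition tmap : tangent X -> tangent Y := @qlift _ _ (@tangent_rel X) _ tmap_sum.
HB.instance Definition _ := GRing.isLinear.Build R (tangent X) (tangent Y) _ tmap
  (qlift_is_linear tmap_sum_rel).

Lemma tmapE (p : plots X) (v : T0 p) :
  tmap (tclass v) = @tclass Y (plots_comp f p) v.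
Proof. by rewrite /tmap (qlift_class tmap_sum_rel) /= dsum_lift_in. Qed.
End TangentMap.

Definition rel_tangent_rel (Y X : based R) : set (plots_sum X) :=
  [set u | exists (p q : plots X) (v : T0 p) (w : T0 q),
     (forall f : germ X Y, tmap f (tclass v) = tmap f (tclass w)) /\
     u = dsum_in v - dsum_in w].

(* T^Y_x(X), for the based spaces Y = (Y,y) and X = (X,x) *)
Definition rel_tangent (Y X : based R) : lmodType R :=
  quotmod (@rel_tangent_rel Y X).

End InternalTangentSpace.
Arguments edom {R} e.
Arguments eucl_proj {R} E z.

Section IrrationalTorus.
Variables (R : realType) (alpha : R).

(* congruence modulo the subgroup Z + alpha Z of R *)
Definition torus_rel (s t : {classic real_line R}) : bool :=
  `[< exists a b : int, (s : R) - (t : R) = a%:~R + b%:~R * alpha >].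

Fact torus_rel_refl : reflexive torus_rel.
Proof. by move=> s; apply/asboolP; exists 0, 0; rewrite subrr mul0r addr0. Qed.
Fact torus_rel_sym : symmetric torus_rel.
Proof.
have h s t : torus_rel s t -> torus_rel t s.
  move=> /asboolP[a [b E]]; apply/asboolP; exists (- a), (- b).
  by rewrite -opprB E opprD !mulrNz mulNr.
by move=> s t; apply/idP/idP; exact: h.
Qed.
Fact torus_rel_trans : transitive torus_rel.
Proof.
move=> t s u /asboolP[a [b E]] /asboolP[c [d F]]; apply/asboolP.
exists (a + c), (b + d).
have -> : (s : R) - (u : R) = ((s : R) - (t : R)) + ((t : R) - (u : R)).
  by rewrite addrA subrK.
by rewrite E F !intrD mulrDl addrACA.
Qed.
Definition torus_equiv : equiv_rel {classic real_line R} :=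
  EquivRel torus_rel torus_rel_refl torus_rel_sym torus_rel_trans.

Definition torus : diffSpace R := quot_space torus_equiv.
End IrrationalTorus.

(* Main.v *)
(* The group [Z + alpha Z] is dense and countable.  Density makes the D-topology
   of the torus indiscrete, so germs are global smooth maps.  Countability makes
   local lifts of plots to the line unique up to a constant, so [p, v] |-> dp~(v),
   for p~ a lift of p, is a well-defined functional, and [p, v] is dp~(v) times
   the class of the projection of the line.  A local lift h of a smooth map
   between tori satisfies h (t + d) - h t = h d - h 0 for small d in
   [Z + alpha Z]; by density h is affine, and its slope l maps [Z + alpha Z] into
   [Z + beta Z].  A slope l <> 0 amounts to the Moebius relation, and then
   composing with the affine map multiplies dp~ by l, so that the functional
   survives in the relative quotient; if only l = 0 occurs, all germs are
   constant and every vector is identified with 0. *)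
From HB Require Import structures.
Require Import Defs.
From mathcomp Require Import all_boot all_order all_algebra.
From mathcomp Require Import all_classical all_reals all_analysis.
From mathcomp Require Import finmap ring lra.
Set Implicit Arguments.
Unset Strict Implicit.
Unset Printing Implicit Defensive.
Import Order.TTheory GRing.Theory Num.Theory.
Import numFieldNormedType.Exports.
Local Open Scope classical_set_scope.
Local Open Scope ring_scope.
Local Open Scope quotient_scope.

Section Lattice.
Variables (R : realType) (alpha : R).

Definition lattice : set R := [set u | exists a b : int, u = a%:~R + b%:~R * alpha].

Lemma lattice1 : lattice 1.
Proof. by exists 1, 0; rewrite mul0r addr0. Qed.

Lemma lattice_gen : lattice alpha.
Proof. by exists 0, 1; rewrite mul1r add0r. Qed.

Lemma latticeB u v : lattice u -> lattice v -> lattice (u - v).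
Proof.
move=> [a [b ->]] [c [d ->]]; exists (a - c), (b - d).
rewrite !rmorphB /=; ring.
Qed.

Lemma lattice0 : lattice 0.
Proof. by rewrite -(subrr 1); apply: latticeB; exact: lattice1. Qed.

Lemma latticeN u : lattice u -> lattice (- u).
Proof. by move=> uL; rewrite -sub0r; apply: latticeB => //; exact: lattice0. Qed.

Lemma latticeD u v : lattice u -> lattice v -> lattice (u + v).
Proof. by move=> uL vL; rewrite -(opprK v); apply/latticeB/latticeN. Qed.

Lemma latticeMz u (n : int) : lattice u -> lattice (n%:~R * u).
Proof.
move=> [a [b ->]]; exists (n * a), (n * b).
rewrite !rmorphM /=; ring.
Qed.

Lemma floor_div_itv (d t : R) : 0 < d ->
  0 <= t - (Num.floor (t / d))%:~R * d < d.
Proof.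
move=> d0; have /andP[h1 h2] := floor_itv (t / d).
rewrite subr_ge0 -ler_pdivlMr // h1 /=.
by rewrite ltrBlDl -[X in _ + X]mul1r -mulrDl -ltr_pdivrMr // -intrD1.
Qed.

Hypothesis alpha_irr : irrational alpha.

(* Otherwise the infimum of the positive elements would generate
   [lattice], making [alpha] rational. *)
Lemma lattice_small (e : R) : 0 < e -> exists d, [/\ lattice d, 0 < d & d < e].
Proof.
move=> e0; apply: contrapT => nsmall.
have lb d : lattice d -> 0 < d -> e <= d.
  by move=> dL d0; rewrite leNgt; apply/negP => de; apply: nsmall; exists d.
pose S := [set d | lattice d /\ 0 < d].
have S1 : S 1 by split; [exact: lattice1 | exact: ltr01].
have lS : has_lbound S by exists e => d [dL d0]; exact: lb.
have iS : has_inf S by split=> //; exists 1.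
have e_le : e <= inf S by apply: lb_le_inf; [exists 1 | move=> d [dL d0]; exact: lb].
have [d [dL d0] dlt] := inf_adherent e0 iS.
have dmin r : lattice r -> 0 <= r -> r < d -> r = 0.
  move=> rL; rewrite le_eqVlt => /predU1P[//|r0] rd.
  have := lb _ (latticeB dL rL); rewrite subr_gt0 => /(_ rd) h.
  have := ge_inf lS (conj rL r0); move: dlt e0 => ? ? ?; lra.
have multd t : lattice t -> t = (Num.floor (t / d))%:~R * d.
  move=> tL; apply/eqP; rewrite -subr_eq0; apply/eqP.
  have /andP[r0 rd] := floor_div_itv t d0.
  by apply: dmin => //; apply: latticeB => //; exact: latticeMz.
apply: alpha_irr; have e1 := multd _ lattice1; have e2 := multd _ lattice_gen.
set m := Num.floor (1 / d) in e1; set n := Num.floor (alpha / d) in e2.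
exists (n%:~R / m%:~R) => //.
have m0 : m%:~R != 0 :> R by apply: contra_eq_neq e1 => ->; rewrite mul0r oner_neq0.
rewrite fmorph_div /= !ratr_int e2; apply: (mulIf m0); rewrite divfK //.
by rewrite -mulrA [d * _]mulrC -e1 mulr1.
Qed.

Lemma lattice_approx (e t : R) : 0 < e ->
  exists d, [/\ lattice d, 0 <= t - d & t - d < e].
Proof.
move=> /lattice_small[d [dL d0 de]].
exists ((Num.floor (t / d))%:~R * d).
have /andP[h1 h2] := floor_div_itv t d0.
by split=> //; [exact: latticeMz | exact: lt_trans h2 de].
Qed.

End Lattice.

Lemma lattice_small_gen (R : realType) (alpha beta l e : R) :
  irrational alpha -> 0 < e ->
  (forall d, lattice alpha d -> 0 <= d -> d < e -> lattice beta (l * d)) ->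
  forall d, lattice alpha d -> lattice beta (l * d).
Proof.
move=> irr e0 H d dL; have [g [gL g0 ge]] := lattice_small irr e0.
have /andP[r0 rg] := floor_div_itv d g0.
rewrite -(subrK ((Num.floor (d / g))%:~R * g) d) mulrDr; apply: latticeD.
  apply: H => //; last exact: lt_trans rg ge.
  by apply: latticeB => //; exact: latticeMz.
by rewrite mulrCA; apply/latticeMz/H => //; exact: ltW.
Qed.

Lemma lattice_countable (R : realType) (alpha : R) : countable (lattice alpha).
Proof.
have -> : lattice alpha = range (fun p : int * int => p.1%:~R + p.2%:~R * alpha).
  by apply/seteqP; split=> [u [a [b ->]]|_ [[a b] _ <-]]; [exists (a, b)|exists a, b].
exact: sub_countable (card_image_le _ _) (countableP _).
Qed.

Lemma countable_itv_miss (R : realType) (C : set R) (a b : R) :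
  countable C -> a < b -> exists2 c, a <= c <= b & ~ C c.
Proof.
move=> cC ab; apply: contrapT => nex.
have sub : [set` `[a, b]] `<=` C.
  move=> c /= cab; by apply: contrapT => nC; apply: nex; exists c.
have := countable_lebesgue_measure0 (sub_countable (subset_card_le sub) cC).
rewrite lebesgue_measure_itv /= lte_fin ab => /eqP.
by rewrite -EFinB eqe subr_eq0 gt_eqF.
Qed.

Lemma within_countable_cst (R : realType) (C : set R) (f : R -> R) (a b : R) :
  countable C -> a <= b -> {within `[a, b], continuous f} ->
  (forall t, a <= t <= b -> C (f t)) -> f a = f b.
Proof.
move=> cC ab cf Cf; apply/eqP/negPn/negP => fab.
have mM : Num.min (f a) (f b) < Num.max (f a) (f b).
  by case: (ltgtP (f a) (f b)) fab => // ->; rewrite eqxx.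
have [c cin nC] := countable_itv_miss cC mM.
have [t tab ft] := IVT ab cf cin.
by apply: nC; rewrite -ft; apply: Cf; move: tab; rewrite in_itv.
Qed.

Section Affine.
Variables (R : realType) (alpha : R) (C : set R) (h : R -> R) (e : R).
Hypotheses (alpha_irr : irrational alpha) (cC : countable C) (e0 : 0 < e).
Hypotheses (dh : derivable h 0 1)
  (ch : forall t, 0 <= t < e -> {for t, continuous h}).
Hypothesis hC : forall d t, lattice alpha d -> 0 <= d -> 0 <= t -> t + d < e ->
  C (h (t + d) - h t).

Lemma quasi_additive d t : lattice alpha d -> 0 <= d -> 0 <= t -> t + d < e ->
  h (t + d) - h 0 = (h t - h 0) + (h d - h 0).
Proof.
move=> dL d0 t0 tde.
have : h (0 + d) - h 0 = h (t + d) - h t.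
  apply: (within_countable_cst (f := fun s => h (s + d) - h s) cC t0).
    apply: continuous_in_subspaceT => s /set_mem /=.
    rewrite in_itv /= => /andP[s0 st].
    apply: cvgB; last by apply: ch; move: e0 => ?; lra.
    apply: (continuous_comp (f := fun s => s + d)); last first.
      by apply: ch; lra.
    by apply: cvgD; [exact: cvg_id | exact: cvg_cst].
  by move=> s /andP[s0 st]; apply: hC => //; lra.
rewrite add0r; lra.
Qed.

Lemma quasi_additiveMn d n : lattice alpha d -> 0 <= d -> n%:R * d < e ->
  h (n%:R * d) - h 0 = n%:R * (h d - h 0).
Proof.
move=> dL d0; elim: n => [|n IH]; first by rewrite !mul0r subrr.
rewrite -natr1 mulrDl mul1r => nde.
have nd0 : 0 <= n%:R * d by rewrite mulr_ge0.
rewrite quasi_additive // IH; [by ring | lra].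
Qed.

Lemma quasi_additive_affine : exists l, forall t, 0 <= t < e -> h t = h 0 + l * t.
Proof.
exists ('D_1 h 0) => t /andP[t0 te]; set l := 'D_1 h 0.
apply/eqP; rewrite -subr_eq0 -normr_le0; apply/ler_addgt0Pr => c c0; rewrite add0r.
pose c' := c / (t + 1).
have t1 : 0 < t + 1 by lra.
have c'0 : 0 < c' by rewrite divr_gt0.
have [s [s0 Hs]] : exists s, 0 < s /\ forall u, 0 <= u < s ->
    `|h u - h 0 - l * u| <= c' * u.
  have := dh; rewrite /derivable -/(derive h 0 1) -/l.
  move=> /cvgr_dist_le/(_ _ c'0); rewrite near_withinE => -[s /= s0 Hs].
  exists s; split=> // u /andP[u0 us].
  have [->|un0] := eqVneq u 0; first by rewrite !mulr0 subrr subrr normr0.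
  have := Hs u; rewrite /= sub0r normrN ger0_norm // => /(_ us un0).
  rewrite addr0 [u *: 1]mulr1 distrC => Hu.
  have up : 0 < u by rewrite lt_def un0.
  rewrite -ler_pdivrMr // -[X in _ / X]ger0_norm // -normf_div.
  by apply: le_trans Hu; rewrite /GRing.scale /= mulrBl mulfK // [_^-1 * _]mulrC.
have [d [dL d0 ds]] := lattice_small alpha_irr s0.
pose n := Num.trunc (t / d).
have /andP[n1 n2] : n%:R <= t / d < n.+1%:R.
  by apply: truncn_itv; rewrite divr_ge0 // ltW.
have nd : n%:R * d <= t by rewrite -ler_pdivlMr.
have nd' : t - n%:R * d < d.
  by rewrite ltrBlDl -[X in _ + X]mul1r -mulrDl natr1 -ltr_pdivrMr.
have nL : lattice alpha (n%:R * d) by rewrite -[n%:R]/(n%:Z%:~R); exact: latticeMz.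
have nd0 : 0 <= n%:R * d by rewrite mulr_ge0 // ltW.
have E : h t - (h 0 + l * t) =
   n%:R * (h d - h 0 - l * d) + (h (t - n%:R * d) - h 0 - l * (t - n%:R * d)).
  have := quasi_additive (t := t - n%:R * d) nL nd0.
  rewrite subrK subr_ge0 => /(_ nd te).
  have := quasi_additiveMn dL (ltW d0) (le_lt_trans nd te).
  move=> e1 e2; rewrite -(subrK (h 0) (h t)) e2 e1; ring.
have h1 : `|h d - h 0 - l * d| <= c' * d by apply: Hs; rewrite ltW.
have h2 : `|h (t - n%:R * d) - h 0 - l * (t - n%:R * d)| <= c' * (t - n%:R * d).
  by apply: Hs; rewrite subr_ge0 nd /=; exact: lt_trans nd' ds.
rewrite E; apply: le_trans (ler_normD _ _) _; rewrite normrM ger0_norm //.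
apply: (@le_trans _ _ (n%:R * (c' * d) + c' * (t - n%:R * d))).
  by apply: lerD => //; exact: ler_wpM2l.
have -> : n%:R * (c' * d) + c' * (t - n%:R * d) = c' * t by ring.
by rewrite /c' mulrAC ler_pdivrMr // ler_pM2l // lerDl.
Qed.
End Affine.

Section Torus.
Variables (R : realType) (alpha : R).

Definition cls (t : R) : torus alpha :=
  \pi_({eq_quot (torus_equiv alpha)}) (t : {classic real_line R}).

Lemma clsP s t : cls s = cls t <-> lattice alpha (s - t).
Proof. by split=> [/eqquotP/asboolP|h]; last exact/eqquotP/asboolP. Qed.

Lemma cls_surj (x : torus alpha) : exists t, x = cls t.
Proof.
exists (repr (x : {eq_quot (torus_equiv alpha)})).
by rewrite /cls reprK.
Qed.

Lemma cls_plot n (U : set 'rV[R]_n) (q : 'rV[R]_n -> R^o) :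
  open U -> smooth U q -> @isplot R (torus alpha) n U (fun z => cls (q z)).
Proof.
by move=> oU sq; split=> // u Uu; exists U, q; split.
Qed.

Lemma torus_plot_lift n (U : set 'rV[R]_n) (p : 'rV[R]_n -> torus alpha) u :
  isplot U p -> U u -> exists U' (q : 'rV[R]_n -> R^o),
    [/\ open U', U' u, U' `<=` U, smooth U' q & forall z, U' z -> p z = cls (q z)].
Proof.
by move=> [oU H] /H[U' [q [U'u UU' [oU' sq] E]]]; exists U', q; split.
Qed.

Lemma smooth_coordv (U : set 'rV[R]_1) : open U -> smooth U (@coordv R 1 0).
Proof.
by move=> oU k; exact: (Ck_lin oU (@coordv_continuous _ _ 0) (@smooth_id _ _ U k)).
Qed.

Hypothesis alpha_irr : irrational alpha.

(* The preimage in the line is open and invariant under a dense subgroup. *)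
Lemma Dopen_torusT (A : set (torus alpha)) x y : Dopen A -> A x -> A y.
Proof.
move=> oA; have [s ->] := cls_surj x; have [t ->] := cls_surj y => Ax.
have := oA _ _ _ (cls_plot openT (smooth_coordv openT)).
rewrite setTI openE => /(_ (const_mx s)); rewrite /preimage /= /coordv mxE => /(_ Ax).
move=> /nbhs_ballP[e /= e0 He].
have [d [dL d0 de]] := lattice_approx alpha_irr (t - s) e0.
have <- : cls (t - d) = cls t.
  by apply/clsP; rewrite addrAC subrr add0r; exact: latticeN.
have := He (const_mx (t - d)); rewrite /= mxE; apply.
split=> // i j; rewrite !mxE /ball /= ltr_norml; move: d0 de e0 => ? ? ?.
by apply/andP; split; lra.
Qed.
End Torus.

Lemma derivable_line (R : realType) (V W : normedModType R) (q : V -> W) (v : V) :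
  derivable q 0 v -> derivable (fun t : R => q (t *: v)) 0 1.
Proof.
rewrite /derivable scale0r; set F := (fun h => _); set G := (fun h => _).
by have -> : G = F; first by apply/funext => h; rewrite /F /G /= !addr0 [h *: 1]mulr1.
Qed.

Lemma torus_map_affine (R : realType) (alpha beta : R)
    (f : torus alpha -> torus beta) : irrational alpha -> dsmooth f ->
  exists l m, (forall t, f (cls alpha t) = cls beta (l * t + m)) /\
    forall d, lattice alpha d -> lattice beta (l * d).
Proof.
move=> irr sf.
have := sf _ _ _ (cls_plot alpha openT (smooth_coordv (@openT _))).
move=> /torus_plot_lift/(_ I)-/(_ (0 : 'rV_1))[U [q [oU U0 _ sq E]]].
pose v : 'rV[R]_1 := const_mx 1.
have [e /= e0 He] : exists2 e, 0 < e & forall t : R, `|t| < e -> U (t *: v).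
  have := open_nbhs_nbhs (conj oU U0) => /nbhs_ballP[e /= e0 He].
  exists e => // t te; apply: He; split=> // i j; rewrite !mxE mulr1 /ball /=.
  by rewrite sub0r normrN.
pose h t := q (t *: v).
have fh t : 0 <= t < e -> f (cls alpha t) = cls beta (h t).
  move=> /andP[t0 te]; rewrite -(E (t *: v)) /= ?/coordv ?mxE ?mulr1 //.
  by apply: He; rewrite ger0_norm.
have ch t : 0 <= t < e -> {for t, continuous h}.
  move=> /andP[t0 te]; apply: continuous_comp; last first.
    by apply: (sq 0%N); apply: He; rewrite ger0_norm.
  by apply: cvgZr_tmp; exact: cvg_id.
have hL d t : lattice alpha d -> 0 <= d -> 0 <= t -> t + d < e ->
    lattice beta (h (t + d) - h t).
  move=> dL d0 t0 tde; apply/clsP; rewrite -!fh; [|lra|lra].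
  by congr f; apply/clsP; rewrite addrAC subrr add0r.
have dh : derivable h 0 1.
  by apply: derivable_line; apply: diff_derivable; exact: (sq 1%N).1.
have [l Hl] := quasi_additive_affine irr (lattice_countable beta) e0 dh ch hL.
have lL : forall d, lattice alpha d -> lattice beta (l * d).
  apply: lattice_small_gen irr e0 _ => d dL d0 de.
  have := hL d 0 dL d0 (lexx 0); rewrite add0r => /(_ de).
  by rewrite Hl ?d0 // addrC addKr.
exists l, (h 0); split=> // t.
have [d [dL d0 de]] := lattice_approx irr t e0.
have -> : cls alpha t = cls alpha (t - d).
  by apply/clsP; rewrite opprB addrC subrK.
rewrite fh ?d0 // Hl ?d0 //; apply/clsP.
have -> : h 0 + l * (t - d) - (l * t + h 0) = - (l * d) by ring.
exact/latticeN/lL.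
Qed.

Definition moebius_related (R : realType) (alpha beta : R) :=
  exists a b c d : int, c%:~R + d%:~R * beta != 0 /\
    alpha = (a%:~R + b%:~R * beta) / (c%:~R + d%:~R * beta).

Lemma moebiusP (R : realType) (alpha beta : R) : moebius_related alpha beta <->
  exists2 l, l != 0 & forall d, lattice alpha d -> lattice beta (l * d).
Proof.
split=> [[a [b [c [d [n0 E]]]]]|[l l0 H]].
  exists (c%:~R + d%:~R * beta) => // u [m [n ->]].
  have -> : (c%:~R + d%:~R * beta) * (m%:~R + n%:~R * alpha) =
      m%:~R * (c%:~R + d%:~R * beta) + n%:~R * (a%:~R + b%:~R * beta).
    by rewrite E; field.
  by apply: latticeD; apply: latticeMz; [exists c, d | exists a, b].
have [c [d E1]] := H _ (lattice1 alpha); have [a [b E2]] := H _ (lattice_gen alpha).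
rewrite mulr1 in E1; exists a, b, c, d; rewrite -E1 -E2; split=> //.
by rewrite mulrAC mulfV // mul1r.
Qed.

Lemma torus_map_cst (R : realType) (alpha beta : R)
    (f : torus alpha -> torus beta) : irrational alpha ->
  ~ moebius_related alpha beta -> dsmooth f -> forall s t, f s = f t.
Proof.
move=> irr nm sf s t; have [l [m [fE lL]]] := torus_map_affine irr sf.
have l0 : l = 0.
  by apply: contrapT => /eqP l0; apply: nm; apply/moebiusP; exists l.
have [[s' ->] [t' ->]] := (cls_surj s, cls_surj t).
by rewrite !fE l0 !mul0r.
Qed.

Section AffineTorusMap.
Variables (R : realType) (alpha beta : R) (l m : R).
Hypothesis lL : forall d, lattice alpha d -> lattice beta (l * d).

Definition torus_affine (x : torus alpha) : torus beta :=
  cls beta (l * repr (x : {eq_quot (torus_equiv alpha)}) + m).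

Lemma torus_affineE t : torus_affine (cls alpha t) = cls beta (l * t + m).
Proof.
apply/clsP; rewrite opprD addrACA subrr addr0 -mulrBr; apply: lL.
by apply/clsP; rewrite /cls reprK.
Qed.

Lemma torus_affine_smooth : dsmooth torus_affine.
Proof.
move=> n U p pp; split=> [|u Uu]; first exact: ds_open pp.
have [U' [q [oU' U'u UU' sq E]]] := torus_plot_lift pp Uu.
exists U', (fun z => l *: q z + m); split=> //.
  split=> // k; apply: CkD => //; last exact: Ck_cst.
  by apply: Ck_scale => //; exact: Ck_cst.
by move=> z /E /= ->; rewrite torus_affineE.
Qed.

Lemma torus_affine_nonconstant : l != 0 ->
  exists s t, torus_affine s <> torus_affine t.
Proof.
move=> l0; have [c _ nc] := countable_itv_miss (lattice_countable beta) (@ltr01 R).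
exists (cls alpha (c / l)), (cls alpha 0) => /=.
rewrite !torus_affineE => /clsP.
by rewrite mulr0 add0r addrK mulrC divfK.
Qed.
End AffineTorusMap.

Lemma nonconstant_moebius (R : realType) (alpha beta : R) : irrational alpha ->
  (exists f : torus alpha -> torus beta, dsmooth f /\ exists s t, f s <> f t) <->
  moebius_related alpha beta.
Proof.
move=> irr; split=> [[f [sf [s [t st]]]]|/moebiusP[l l0 lL]].
  by apply: contrapT => nm; apply: st; exact: torus_map_cst.
exists (torus_affine beta l 0); split; first exact: torus_affine_smooth.
exact: torus_affine_nonconstant.
Qed.

Lemma diff_shift (R : realType) (V W : normedModType R) (q : V -> W) (c : W) x :
  differentiable q x -> 'd (fun z => q z + c) x = 'd q x :> (V -> W).
Proof.
move=> dq; have dc : differentiable (cst c : V -> W) x by exact: differentiable_cst.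
apply: (etrans (diffD dq dc)); apply/funext => v.
exact: (etrans (congr1 (fun L : V -> W => 'd q x v + L v) (diff_cst c x)) (addr0 _)).
Qed.

Lemma near_diffE (R : realType) (V W : normedModType R) (q1 q2 : V -> W) (c : W) x :
  (\forall z \near x, q1 z = q2 z + c) -> differentiable q1 x -> differentiable q2 x ->
   'd q1 x = 'd q2 x:> (_ -> _).
Proof.
move=> H d1 d2.
exact: etrans (esym (near_diff H d1).2) (diff_shift _ d2).
Qed.

Lemma eucl_proj0 (R : realType) (E : eucl R) : eucl_proj E 0 = bpt (eucl_based E).
Proof. by rewrite -[0]/(set_val (bpt (eucl_based E))) eucl_proj_val. Qed.

Lemma dsum_supp_sum (R : pzRingType) (I : choiceType) (V : I -> lmodType R)
    (u : dsum V) :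
  u = \sum_(i <- fset_set [set i | u i != 0]) dsum_in (u i).
Proof.
apply: dsumP => j.
rewrite (big_morph (fun f : dsum V => f j) (id1 := 0) (op1 := +%R)) //=.
have [uj|uj] := eqVneq (u j) 0.
  rewrite big1 // => i _; have [ij|ij] := eqVneq i j; last by rewrite dfwith_out.
  by subst i; rewrite dfwith_in.
rewrite (bigD1_seq j) /=; last by exact: finmap.fset_uniq.
  rewrite dfwith_in big1 ?addr0 // => i ij; by rewrite dfwith_out.
rewrite (in_fset_set (dsum_finite u)).
exact: mem_set.
Qed.

Section LocalLift.
Variables (R : realType) (alpha : R).

Lemma loc_lattice_cst n (W : set 'rV[R]_n) (q1 q2 : 'rV[R]_n -> R^o) :
  open W -> W 0 -> smooth W q1 -> smooth W q2 ->
  (forall z, W z -> lattice alpha (q1 z - q2 z)) ->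
  \forall z \near (0 : 'rV[R]_n), q1 z = q2 z + (q1 0 - q2 0).
Proof.
move=> oW W0 s1 s2 L.
have := open_nbhs_nbhs (conj oW W0) => /nbhs_ballP[e /= e0 He].
apply/nbhs_ballP; exists e => //= z ze.
have Wt t : 0 <= t <= 1 -> W (t *: z).
  move=> /andP[t0 t1]; apply: He; move: ze; rewrite -!ball_normE /= !sub0r !normrN.
  by apply: le_lt_trans; rewrite normrZ ger0_norm // ler_piMl.
pose k (t : R) : R := q1 (t *: z) - q2 (t *: z).
have : k 0 = k 1.
  apply: (within_countable_cst (lattice_countable alpha) ler01); last by move=> t /Wt/L.
  apply: continuous_in_subspaceT => t /set_mem /=; rewrite in_itv /= => /Wt Wtz.
  have cz : {for t, continuous (fun t : R => t *: z)} by apply: cvgZr_tmp; exact: cvg_id.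
  by apply: cvgB; apply: (continuous_comp cz); [exact: (s1 0%N) | exact: (s2 0%N)].
rewrite /k scale0r scale1r => ->; by rewrite addrC subrK.
Qed.

Lemma loc_lattice_diff n (W : set 'rV[R]_n) (q1 q2 : 'rV[R]_n -> R^o) :
  open W -> W 0 -> smooth W q1 -> smooth W q2 ->
  (forall z, W z -> lattice alpha (q1 z - q2 z)) ->
  'd q1 (0 : 'rV[R]_n) = 'd q2 (0 : 'rV[R]_n) :> (_ -> _).
Proof.
move=> oW W0 s1 s2 L.
have d1 : differentiable q1 0 by exact: (s1 1%N).1.
have d2 : differentiable q2 0 by exact: (s2 1%N).1.
exact: near_diffE (loc_lattice_cst oW W0 s1 s2 L) d1 d2.
Qed.

Definition is_lift (E : eucl R) (g : set_type (edom E) -> torus alpha)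
    (q : 'rV[R]_(edim E) -> R^o) :=
  exists U : set 'rV[R]_(edim E), [/\ open U, U 0, U `<=` edom E, smooth U q &
    forall z, U z -> g (eucl_proj E z) = cls alpha (q z)].

Lemma is_lift_unique (E : eucl R) (g : set_type (edom E) -> torus alpha) q1 q2 :
  is_lift g q1 -> is_lift g q2 ->
  'd q1 (0 : 'rV[R]_(edim E)) = 'd q2 (0 : 'rV[R]_(edim E)) :> (_ -> _).
Proof.
move=> [U1 [oU1 U10 UE1 s1 E1]] [U2 [oU2 U20 UE2 s2 E2]].
apply: (@loc_lattice_diff _ (U1 `&` U2)) => //; first exact: openI.
- by move=> k; exact: Ck_sub (@subIsetl _ _ _) (s1 k).
- by move=> k; exact: Ck_sub (@subIsetr _ _ _) (s2 k).
- by move=> z [U1z U2z]; apply/clsP; rewrite -E1 // -E2.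
Qed.

Variable x : torus alpha.
Let X := @Based R (torus alpha) x.

Lemma lift_exists (E : eucl R) (g : locmap (eucl_based E) X) :
  exists q, is_lift (g : _ -> _) q.
Proof.
have [A [oA A0 sg]] := lm_smooth g.
pose V := edom E `&` eucl_proj E @^-1` A.
have oV : open V by apply: oA; exact: eucl_proj_plot.
have V0 : V 0.
  split; [exact: edom0 | rewrite /= eucl_proj0 //].
have pV := isplot_sub oV (@subIsetl _ _ _) (eucl_proj_plot E).
have [U [q [oU U0 UV sq H]]] :=
  torus_plot_lift (sg _ _ _ pV (fun u (h : V u) => h.2)) V0.
by exists q, U; split=> // z /UV[].
Qed.

Lemma is_lift_germ (E : eucl R) (g g' : locmap (eucl_based E) X) q :
  to_germ g = to_germ g' -> is_lift (g : _ -> _) q -> is_lift (g' : _ -> _) q.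
Proof.
move=> /to_germP[A [oA A0 gg']] [U [oU U0 UE sq H]].
have oV : open (edom E `&` eucl_proj E @^-1` A) by apply: oA; exact: eucl_proj_plot.
exists (U `&` (edom E `&` eucl_proj E @^-1` A)); split.
- exact: openI.
- split=> //; split; first exact: edom0.
  by rewrite /= eucl_proj0.
- by move=> z [/UE].
- by move=> k; exact: Ck_sub (@subIsetl _ _ _) (sq k).
- by move=> z [Uz [_ Az]]; rewrite -gg' // H.
Qed.

Definition dlift (p : plots X) : {linear T0 p -> R^o} :=
  'd (projT1 (cid (lift_exists (germ_rep (pgerm p))))) (0 : 'rV[R]_(edim (pdom p))).

Lemma dliftE (E : eucl R) (g : locmap (eucl_based E) X) q :
  is_lift (g : _ -> _) q ->
  dlift (Plot (to_germ g)) = 'd q (0 : 'rV[R]_(edim E)) :> ('rV[R]_(edim E) -> R^o).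
Proof.
move=> gq; rewrite /dlift /=; case: cid => q' /= Hq'.
apply: (is_lift_unique _ gq); apply: is_lift_germ Hq'; exact: germ_repK.
Qed.

Lemma dlift_precomp (p q : plots X)
    (f : germ (eucl_based (pdom p)) (eucl_based (pdom q))) v :
  pgerm p = germ_comp (pgerm q) f -> dlift p v = dlift q (germ_diff f v).
Proof.
case: p q f v => [E g] [F h] f v /= ->; rewrite /germ_comp.
have [q Hq] := lift_exists (germ_rep h).
have [U [oU U0 UF sq H]] := Hq.
have [V [oV V0 VE sf]] := locmap_smooth_near (germ_rep f).
set phi := valL_ _ _ in sf.
have phi0 : phi 0 = 0.
  rewrite /phi valL_edom; last exact: edom0.
  by rewrite eucl_proj0 /= lm_pt.
have L : is_lift (locmap_comp (germ_rep h) (germ_rep f) : _ -> _) (q \o phi).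
  exists (V `&` phi @^-1` U); split.
  - exact: open_preim oV oU (sf 0%N).
  - by split=> //=; rewrite phi0.
  - by move=> z [/VE].
  - move=> k; apply: Ck_comp (sq k) _ => [|z []//|].
      exact: open_preim oV oU (sf 0%N).
    exact: Ck_sub (@subIsetl _ _ _) (sf k).
  - move=> z [Vz Uz] /=; rewrite -H // /phi valL_edom; last exact: VE.
    by rewrite eucl_proj_val.
rewrite (dliftE L) -[h in RHS]germ_repK (dliftE Hq).
have dphi : differentiable phi 0 by exact: (sf 1%N).1.
have dq : differentiable q (phi 0) by rewrite phi0; exact: (sq 1%N).1.
by rewrite (diff_comp dphi dq) /= phi0.
Qed.

Definition dlift_sum : {linear plots_sum X -> R^o} := dsum_lift dlift.

Lemma dlift_tclass (p q : plots X) (v : T0 p) (w : T0 q) :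
  tclass v = tclass w -> dlift p v = dlift q w.
Proof.
have kill s : @tangent_rel R X s -> dlift_sum s = 0.
  move=> [p' [q' [f [v' [w' [E <- ->]]]]]].
  by rewrite linearB /= !dsum_lift_in (dlift_precomp _ E) subrr.
move=> vw; have := congr1 (qlift dlift_sum) vw.
by rewrite /tclass !(qlift_class kill) /= !dsum_lift_in.
Qed.

End LocalLift.

Lemma smooth_shift (R : realType) n (U : set 'rV[R]_n) (q : 'rV[R]_n -> R^o) (c : R^o) :
  open U -> smooth U q -> smooth U (fun z => q z + c).
Proof. by move=> oU sq k; apply: CkD => //; exact: Ck_cst. Qed.

Lemma DopenT (R : realType) (S : diffSpace R) : Dopen (@setT S).
Proof. by move=> n U p pp; rewrite preimage_setT setIT; exact: ds_open pp. Qed.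

Section UnitPlot.
Variables (R : realType) (alpha x0 : R).
Let X := @Based R (torus alpha) (cls alpha x0).

Definition eucl_full n : eucl R := Eucl (@openT 'rV[R]_n) I.

Definition unit_fun (z : set_type (edom (eucl_full 1))) : torus alpha :=
  cls alpha ((set_val z : 'rV[R]_1) 0 0 + x0).

Lemma unit_fun_smooth : @dsmooth_on R (eucl_based (eucl_full 1)) X setT unit_fun.
Proof.
move=> n U p [oU sp] _.
apply: (cls_plot alpha (q := fun z => coordv 0 (set_val (p z)) + x0)) => //.
apply: smooth_shift => // k.
exact: (Ck_lin oU (@coordv_continuous _ _ 0) (sp k)).
Qed.

Lemma unit_fun_pt : unit_fun (bpt (eucl_based (eucl_full 1))) = bpt X.
Proof.
by rewrite /unit_fun -eucl_proj0 eucl_projK //= mxE add0r.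
Qed.

Definition unit_locmap : locmap (eucl_based (eucl_full 1)) X :=
  @LocMap R (eucl_based (eucl_full 1)) X unit_fun unit_fun_pt
   (ex_intro _ setT (And3 (@DopenT _ _) I unit_fun_smooth)).

Definition unit_plot : plots X := Plot (to_germ unit_locmap).

Lemma unit_plot_dlift (w : 'rV[R]_1) : dlift unit_plot w = w 0 0.
Proof.
pose q (z : 'rV[R]_1) : R^o := coordv 0 z + x0.
have L : is_lift (unit_locmap : _ -> _) q.
  exists setT; split=> //; first exact: openT.
    by apply: smooth_shift; [exact: openT | apply: smooth_coordv; exact: openT].
  by move=> z _; rewrite /= /unit_fun eucl_projK.
rewrite (dliftE L).
have dq : differentiable (@coordv R 1 0) 0 by exact: differentiable_coord.
by rewrite (diff_shift _ dq) (diff_lin _ (@coordv_continuous _ _ 0)).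
Qed.

Section Factor.
Variables (E : eucl R) (g : locmap (eucl_based E) X).

Lemma factor_unit : exists f : germ (eucl_based E) (eucl_based (eucl_full 1)),
  to_germ g = germ_comp (to_germ unit_locmap) f.
Proof.
have [q [U [oU U0 UE sq H]]] := lift_exists g.
pose a (z : 'rV[R]_(edim E)) : 'rV[R]_1 := (q z - q 0) *: const_mx 1.
have sa : smooth U a.
  by move=> k; apply: Ck_scale => //; [exact: smooth_shift | exact: Ck_cst].
pose phi (z : eucl_based E) : eucl_based (eucl_full 1) :=
  eucl_proj (eucl_full 1) (a (set_val z)).
have phiE z : set_val (phi z) = a (set_val z) by exact: eucl_projK.
have phi_pt : phi (bpt (eucl_based E)) = bpt (eucl_based (eucl_full 1)).
  by rewrite -eucl_proj0 /phi eucl_projK ?/a ?subrr ?scale0r ?eucl_proj0 //; exact: edom0.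
pose A : set (eucl_based E) := set_val @^-1` U.
have oA : Dopen A.
  by move=> n W p [oW sp]; exact: (open_preim oW oU (sp 0%N)).
have A0 : A (bpt (eucl_based E)).
  by rewrite /A -eucl_proj0 /= eucl_projK //; exact: edom0.
have sphi : dsmooth_on A phi.
  move=> n W p [oW sp] WA; split=> // k.
  have -> : set_val \o (phi \o p) = a \o (set_val \o p).
    by apply/funext => z; exact: phiE.
  exact: Ck_comp oW WA (sa k) (sp k).
pose f := LocMap phi_pt (ex_intro _ A (And3 oA A0 sphi)).
exists (to_germ f); rewrite germ_compE; apply/to_germP; exists A; split=> // z Uz.
rewrite /= /unit_fun phiE /a !mxE mulr1.
have -> : g z = cls alpha (q (set_val z)) by rewrite -H // eucl_proj_val.
have E0 : cls alpha (q 0) = cls alpha x0.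
  by rewrite -H // eucl_proj0 lm_pt.
apply/clsP; have := (clsP _ _ _).1 E0.
by rewrite opprD opprB addrA [q (set_val z) + _]addrC subrK.
Qed.
End Factor.

Lemma tclass_unit (p : plots X) (v : T0 p) :
  tclass v = dlift p v *: tclass (const_mx 1 : T0 unit_plot).
Proof.
case: p v => E g v; have [f Ef] := factor_unit (germ_rep g).
rewrite germ_repK in Ef.
have D := dlift_precomp (p := Plot g) (q := unit_plot) v Ef.
rewrite D unit_plot_dlift.
have -> : tclass v = @tclass R X unit_plot (germ_diff f v).
  apply/qclassP/sub_lspan.
  by exists (Plot g), unit_plot, f, v, (germ_diff f v).
rewrite /tclass -!linearZ /=; congr (tclass _).
by apply/rowP => i; rewrite !mxE mulr1 ord1.
Qed.
End UnitPlot.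

Section PositiveCase.
Variables (R : realType) (alpha beta x0 y0 l : R).
Let X := @Based R (torus alpha) (cls alpha x0).
Let Y := @Based R (torus beta) (cls beta y0).
Hypothesis l0 : l != 0.
Hypothesis lL : forall d, lattice alpha d -> lattice beta (l * d).

Lemma affine_pt : torus_affine beta l (y0 - l * x0) (bpt X) = bpt Y.
Proof. by rewrite torus_affineE // addrC subrK. Qed.

Lemma affine_smooth_on : @dsmooth_on R X Y setT (torus_affine beta l (y0 - l * x0)).
Proof. by move=> n U p pp _; exact: torus_affine_smooth. Qed.

Definition affine_locmap : locmap X Y :=
  @LocMap R X Y _ affine_pt (ex_intro _ setT (And3 (@DopenT _ _) I affine_smooth_on)).

Lemma dlift_affine (p : plots X) (v : T0 p) :
  @dlift R beta _ (plots_comp (to_germ affine_locmap) p) v = l * dlift p v.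
Proof.
case: p v => E g v; rewrite -[g]germ_repK; set h := germ_rep g.
rewrite /plots_comp /= germ_compE.
have [q Lq] := lift_exists h; have [U [oU U0 UE sq H]] := Lq.
have L : is_lift (locmap_comp affine_locmap h : _ -> _)
    (fun z => (l *: q) z + (y0 - l * x0)).
  exists U; split=> //.
    by apply: smooth_shift => // k; apply: Ck_scale => //; exact: Ck_cst.
  by move=> z Uz; rewrite /= H // torus_affineE.
have dq : differentiable q 0 by exact: (sq 1%N).1.
apply: etrans (congr1 (@^~ v) (dliftE L)) _.
apply: etrans _ (congr1 (fun D => l * D v) (esym (dliftE Lq))).
apply: etrans (congr1 (@^~ v) (diff_shift _ (differentiableZ l dq))) _.
exact: (congr1 (@^~ v) (diffZ l dq)).
Qed.

Lemma rel_tangent_rel_dlift (p q : plots X) (v : T0 p) (w : T0 q) :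
  (forall f : germ X Y, tmap f (tclass v) = tmap f (tclass w)) ->
  dlift p v = dlift q w.
Proof.
move=> /(_ (to_germ affine_locmap)) H; apply: (mulfI l0).
have := dlift_tclass (etrans (esym (tmapE _ v)) (etrans H (tmapE _ w))).
by move=> D; exact: etrans (esym (dlift_affine v)) (etrans D (dlift_affine w)).
Qed.

Lemma dlift_sum_kill s : @rel_tangent_rel R Y X s -> dlift_sum _ s = 0.
Proof.
move=> [p [q [v [w [H ->]]]]].
by rewrite linearB /= !dsum_lift_in (rel_tangent_rel_dlift H) subrr.
Qed.

Lemma rel_tangent_iso_line : lmod_iso (rel_tangent Y X) R^o.
Proof.
pose S := @rel_tangent_rel R Y X.
pose e : rel_tangent Y X := qclass S (dsum_in (const_mx 1 : T0 (unit_plot alpha x0))).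
pose Phi := qlift (S := S) (dlift_sum (cls alpha x0)).
pose isL := GRing.isLinear.Build R (rel_tangent Y X) R^o _ Phi
  (qlift_is_linear dlift_sum_kill).
pose PhiL : {linear rel_tangent Y X -> R^o} := HB.pack Phi isL.
exists PhiL; exists (fun c => c *: e); last first.
  move=> c; rewrite linearZ /= /Phi (qlift_class dlift_sum_kill) /= dsum_lift_in.
  by rewrite unit_plot_dlift mxE /GRing.scale /= mulr1.
have gen (p : plots X) (v : T0 p) : qclass S (dsum_in v) = dlift p v *: e.
  rewrite /e -linearZ -linearZ /=; apply/qclassP/sub_lspan.
  exists p, (unit_plot alpha x0), v, (dlift p v *: const_mx 1); split=> // f.
  by congr (tmap f _); rewrite tclass_unit /tclass -!linearZ.
move=> t; rewrite -[t]qclass_repr /= /Phi (qlift_class dlift_sum_kill).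
rewrite [repr t]dsum_supp_sum !linear_sum scaler_suml; apply: eq_bigr => p _.
rewrite /= dsum_lift_in; exact: esym (gen p _).
Qed.
End PositiveCase.

Section ZeroCase.
Variable R : realType.

Fact cst_locmap_subproof (X Y : based R) :
  exists A : set X, [/\ Dopen A, A (bpt X) & dsmooth_on A (fun=> bpt Y)].
Proof.
exists setT; split=> //; first exact: DopenT.
by move=> n U p pp _; apply: ds_cover; exact: ds_open pp.
Qed.
Definition cst_locmap (X Y : based R) : locmap X Y :=
  LocMap (erefl (bpt Y)) (cst_locmap_subproof X Y).

(* A constant plot factors through the point [R^0]. *)
Lemma tclass_cst (X : based R) (E : eucl R) (v : 'rV[R]_(edim E)) :
  @tclass R X (Plot (to_germ (cst_locmap (eucl_based E) X))) v = 0.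
Proof.
pose q := Plot (to_germ (cst_locmap (eucl_based (eucl_full R 0)) X)).
pose f := to_germ (cst_locmap (eucl_based E) (eucl_based (eucl_full R 0))).
have -> : 0 = tclass (0 : T0 q) by rewrite /tclass !linear0.
apply/qclassP/sub_lspan.
exists (Plot (to_germ (cst_locmap (eucl_based E) X))), q, f, v, 0; split=> //=.
  by rewrite germ_compE; apply/to_germP; exists setT; split=> //; exact: DopenT.
by apply/rowP => -[].
Qed.

Lemma rel_tangent_zero (X Y : based R) :
  (forall f : locmap X Y, forall z, f z = bpt Y) ->
  lmod_iso (rel_tangent Y X) 'rV[R]_0.
Proof.
move=> fcst; pose S := @rel_tangent_rel R Y X.
have tm0 (f : germ X Y) (p : plots X) (v : T0 p) : tmap f (tclass v) = 0.
  have Ef : germ_comp f (pgerm p) = to_germ (cst_locmap (eucl_based (pdom p)) Y).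
    apply/to_germP; exists setT; split=> // [|z _]; first exact: DopenT.
    exact: fcst.
  by rewrite tmapE /plots_comp Ef; exact: tclass_cst.
have gen (p : plots X) (v : T0 p) : qclass S (dsum_in v) = 0.
  rewrite -(linear0 (qclass S)); apply/qclassP/sub_lspan.
  exists p, p, v, 0; split=> [f|]; first by rewrite !tm0.
  by rewrite [X in _ = _ - X]linear0.
have tan0 (t : rel_tangent Y X) : t = 0.
  rewrite -[t]qclass_repr [repr t]dsum_supp_sum linear_sum big1 // => p _.
  exact: gen.
exists (\0 : {linear rel_tangent Y X -> 'rV[R]_0}); exists (fun=> 0).
  by move=> t; rewrite [t]tan0.
by move=> u; apply/rowP => -[].
Qed.
End ZeroCase.

Lemma locmap_torus_cst (R : realType) (alpha beta : R) x y
    (f : locmap (@Based R (torus alpha) x) (@Based R (torus beta) y)) z :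
  irrational alpha -> ~ moebius_related alpha beta -> f z = y.
Proof.
move=> irr nm; have [A [oA Ax sf]] := lm_smooth f.
have dsf : dsmooth (f : torus alpha -> torus beta).
  by move=> n U p pp; apply: sf => // u _;
    exact: (@Dopen_torusT _ _ irr A x (p u) oA Ax).
by rewrite (torus_map_cst irr nm dsf z x); exact: lm_pt.
Qed.

Theorem theorem3p6 (R : realType) (alpha beta : R)
    (halpha : irrational alpha) (hbeta : irrational beta)
    (x : torus alpha) (y : torus beta) :
  let T := rel_tangent (@Based R (torus beta) y) (@Based R (torus alpha) x) in
  let nonconstant_smooth := exists f : torus alpha -> torus beta,
    dsmooth f /\ exists s t, f s <> f t in
  let moebius := exists a b c d : int,
    c%:~R + d%:~R * beta != 0 /\
    alpha = (a%:~R + b%:~R * beta) / (c%:~R + d%:~R * beta) in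
  ((nonconstant_smooth -> lmod_iso T R^o) /\
   (~ nonconstant_smooth -> lmod_iso T 'rV[R]_0)) /\
  ((moebius -> lmod_iso T R^o) /\
   (~ moebius -> lmod_iso T 'rV[R]_0)).
Proof.
move=> T nonconstant_smooth mb.
have iso1 : mb -> lmod_iso T R^o.
  have [[x0 xE] [y0 yE]] := (cls_surj x, cls_surj y).
  rewrite /T xE yE => /moebiusP[l l0 lL]; exact: rel_tangent_iso_line l0 lL.
have iso0 : ~ mb -> lmod_iso T 'rV[R]_0.
  by move=> nm; apply: rel_tangent_zero => f z; exact: locmap_torus_cst.
have ncP : nonconstant_smooth <-> mb := nonconstant_moebius beta halpha.
split; split=> //.
  by move=> /ncP.
by move=> nc; apply: iso0 => /ncP.
Qed.
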